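(* Let $G$ be a finite undirected graph. Then $$\max_{\vec G}\psi_d^*(\vec G)=\chi^*(G),$$ where the maximum is taken over all orientations $\vec G$ of $G$.
   Context: $S(G)$ denotes the set of independent sets of $G$. A fractional coloring of $G$ is a family $(x_A)_{A\in S(G)}$ of nonnegative reals with $\sum_{A\ni v}x_A\ge1$ for every vertex $v$; $\chi^*(G)$ is the minimum total weight $\sum_A x_A$ of a fractional coloring. An orientation $\vec G$ of $G$ contains each edge of $G$ with exactly one of its two orientations and no other arcs. A fractional coloring of a digraph $\vec G$ is a fractional coloring of its underlying undirected graph $G$; its local weight is $1+\max_{v\in V(\vec G)}\sum_{A\in S(G):\,N_+(v)\cap A\ne\emptyset}x_A$, where $N_+(v)$ is the set of out-neighbors of $v$. The fractional directed local chromatic number $\psi_d^*(\vec G)$ is the minimum local weight of a fractional coloring of $\vec G$. *)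

(* Defs.v *)
From HB Require Import structures.
From mathcomp Require Import all_boot all_order all_algebra.
From mathcomp Require Import all_classical all_reals.

Set Implicit Arguments.
Unset Strict Implicit.
Unset Printing Implicit Defensive.

Import Order.TTheory GRing.Theory Num.Theory.

Local Open Scope ring_scope.
Local Open Scope classical_set_scope.

(* Graphs and digraphs on a finite vertex type V are given by their (boolean)
   adjacency relations; [E] is a graph when it is symmetric and irreflexive.
   [D v u] means that there is an arc from v to u. *)

Definition is_minimum (R : realType) (A : set R) (m : R) : Prop :=
  A m /\ lbound A m.

Definition is_maximum (R : realType) (A : set R) (m : R) : Prop :=
  A m /\ ubound A m.

Definition indep_sets (V : finType) (E : rel V) : {set {set V}} :=
  [set A : {set V} | [forall u in A, forall v in A, ~~ E u v]]%SET.

(* The family is indexed by all subsets of V, but the values outside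
   [indep_sets E] are irrelevant: they are neither constrained here nor used in
   the weights below. *)
Definition fractional_coloring (R : realType) (V : finType) (E : rel V)
    (x : {set V} -> R) : Prop :=
  (forall A, A \in indep_sets E -> 0 <= x A) /\
  (forall v, 1 <= \sum_(A in indep_sets E | v \in A) x A).

Definition total_weight (R : realType) (V : finType) (E : rel V)
    (x : {set V} -> R) : R :=
  \sum_(A in indep_sets E) x A.

Definition total_weights (R : realType) (V : finType) (E : rel V) : set R :=
  [set total_weight E x | x in [set x | fractional_coloring E x]].
Arguments total_weights R {V} E.

(* The minimum total weight, named through [inf]. *)
Definition fractional_chromatic_number (R : realType) (V : finType)
    (E : rel V) : R :=
  inf (total_weights R E).
Arguments fractional_chromatic_number R {V} E.

Definition underlying (V : finType) (D : rel V) : rel V :=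
  fun u v => D u v || D v u.

Definition is_orientation (V : finType) (E D : rel V) : Prop :=
  (forall u v, D u v -> E u v) /\ (forall u v, E u v -> D u v (+) D v u).

Definition out_neighbors (V : finType) (D : rel V) (v : V) : {set V} :=
  [set u | D v u]%SET.

(* The default value 0 of the maximum is harmless: the sums are nonnegative for
   a fractional coloring, so it only matters when V is empty. *)
Definition local_weight (R : realType) (V : finType) (D : rel V)
    (x : {set V} -> R) : R :=
  1 + \big[Num.max/0]_(v : V)
        \sum_(A in indep_sets (underlying D) |
              (out_neighbors D v :&: A)%SET != finset.set0) x A.

Definition local_weights (R : realType) (V : finType) (D : rel V) : set R :=
  [set local_weight D x | x in [set x | fractional_coloring (underlying D) x]].
Arguments local_weights R {V} D.

(* The minimum local weight, named through [inf]. *)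
Definition fractional_directed_local_chromatic_number (R : realType)
    (V : finType) (D : rel V) : R :=
  inf (local_weights R D).
Arguments fractional_directed_local_chromatic_number R {V} D.

(* Main.v *)
(* For the upper bound, an independent set containing v misses the neighbors of
   v; these sets have total weight at least 1, so the local weight of a
   fractional coloring is at most its total weight.

   For the lower bound, LP duality gives weights z >= 0 on the vertices, of sum
   at least chi^* and with z(A) <= 1 for every independent set A. Averaging z(A)
   with an optimal fractional coloring shows that some independent set B has
   z(B) = 1. Orient all edges meeting B out of B. For A independent, the v in B
   with an out-neighbor in A have total z-weight at least z(A \ B). Averaging
   over v in B with weights z, every fractional coloring x thus has a v in B
   for which the sets meeting N_+(v) weigh at least
   sum_A x_A z(A \ B) >= z(V \ B) >= chi^* - 1.

   LP duality and the attainment of the minima both come from Farkas' lemma,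
   which is obtained by Fourier-Motzkin elimination. *)

Require Import Defs.
From mathcomp Require Import all_boot all_order all_algebra.
From mathcomp Require Import all_classical all_reals.
From mathcomp Require Import lra.

Set Implicit Arguments.
Unset Strict Implicit.
Unset Printing Implicit Defensive.

Import Order.TTheory GRing.Theory Num.Theory.

Local Open Scope ring_scope.
Local Open Scope classical_set_scope.

(** * Linear inequalities: elimination, Farkas' lemma, attained minima *)

Lemma exists_between (R : realFieldType) (I : finType) (P Q : pred I)
    (f : I -> R) :
  (forall i k, P i -> Q k -> f i <= f k) ->
  exists t, (forall i, P i -> f i <= t) /\ (forall k, Q k -> t <= f k).
Proof.
move=> fPQ; case: (pickP P) => [i0 Pi0|P0].
  exists (f [arg max_(i > i0 | P i) f i]%O).
  by case: arg_maxP => // i Pi imax; split=> [j /imax|k Qk] //; exact: fPQ.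
case: (pickP Q) => [k0 Qk0|Q0].
  exists (f [arg min_(k < k0 | Q k) f k]%O).
  by case: arg_minP => // k Qk kmin; split=> [i|j /kmin] //; rewrite P0.
by exists 0; split=> i; rewrite ?P0 ?Q0.
Qed.

(** Induction on the list of variables; elimination changes the rows, so [I] is quantified inside
    the induction. Each row with a positive coefficient of the eliminated variable is paired with
    each row with a negative one, and the rows with coefficient zero are kept. Both alternatives for
    the new system lift back to the old one. *)
Lemma fourier_motzkin (R : realFieldType) (J : eqType) (s : seq J) :
  uniq s -> forall (I : finType) (a : I -> J -> R) (b : I -> R),
  (exists x, forall i, \sum_(j <- s) a i j * x j <= b i) \/
  (exists y, [/\ forall i, 0 <= y i,
     forall j, j \in s -> \sum_i y i * a i j = 0 & \sum_i y i * b i < 0]).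
Proof.
elim: s => [|j0 s IHs] /= => [_|/andP[j0s s_uniq]] I a b.
  case: (pickP (fun i => b i < 0)) => [i bi|b_ge0]; [right | left].
    exists (fun l => (l == i)%:R); split=> //; rewrite (bigD1 i) //= eqxx mul1r.
    by rewrite big1 ?addr0 // => l /negPf->; rewrite mul0r.
  by exists (fun=> 0) => i; rewrite big_nil leNgt b_ge0.
pose e i := a i j0.
(* Nonnegative combinations of the rows in which the variable [j0] cancels. *)
pose w (p : I * I + I) l : R :=
  match p with
  | inl (i, k) => if (0 < e i) && (e k < 0)
                  then (l == k)%:R * e i - (l == i)%:R * e k else 0
  | inr i => if e i == 0 then (l == i)%:R else 0
  end.
have sum_delta i (c : I -> R) : \sum_l (l == i)%:R * c l = c i.
  rewrite (bigD1 i) //= eqxx mul1r big1 ?addr0 // => l /negPf->.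
  by rewrite mul0r.
have w_pair i k c : 0 < e i -> e k < 0 ->
    \sum_l w (inl (i, k)) l * c l = e i * c k - e k * c i.
  move=> ei ek; under eq_bigr do rewrite /w ei ek /= mulrBl -!mulrA.
  by rewrite sumrB !sum_delta.
have w_single i c : e i = 0 -> \sum_l w (inr i) l * c l = c i.
  by move=> ei; under eq_bigr do rewrite /w ei eqxx; rewrite sum_delta.
have w_ge0 p l : 0 <= w p l.
  case: p => [[i k]|i] /=; last by case: ifP.
  case: ifP => // /andP[ei ek].
  by rewrite subr_ge0 (le_trans (y := 0)) ?mulr_ge0 ?mulr_ge0_le0 // ltW.
have w_e p : \sum_l w p l * e l = 0.
  case: p => [[i k]|i].
    have [/andP[ei ek]|pN] := boolP ((0 < e i) && (e k < 0)).
      by rewrite w_pair // mulrC subrr.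
    by rewrite big1 // => l _; rewrite /w (negPf pN) mul0r.
  have [ei|eN] := eqVneq (e i) 0; first by rewrite w_single.
  by rewrite big1 // => l _; rewrite /w (negPf eN) mul0r.
have [[x xP]|[y [y_ge0 ya yb]]] := IHs s_uniq _
    (fun p j => \sum_l w p l * a l j) (fun p => \sum_l w p l * b l).
  left; pose r i := b i - \sum_(j <- s) a i j * x j.
  have r_ge0 p : 0 <= \sum_l w p l * r l.
    suff -> : \sum_l w p l * r l = \sum_l w p l * b l
        - \sum_(j <- s) (\sum_l w p l * a l j) * x j by rewrite subr_ge0.
    under eq_bigr do rewrite mulrBr.
    rewrite sumrB; congr (_ - _).
    under [RHS]eq_bigr do rewrite mulr_suml.
    rewrite exchange_big; apply: eq_bigr => l _; rewrite mulr_sumr.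
    by apply: eq_bigr => j _; rewrite mulrA.
  (* Row [i] asks for [e i * t <= r i]: a lower bound on [t] if [e i < 0], an upper bound if
     [0 < e i]. The paired rows make these bounds compatible. *)
  have [|t [t_ge t_le]] := @exists_between R I
      (fun i => e i < 0) (fun i => 0 < e i) (fun i => r i / e i).
    move=> k i ek ei; have := r_ge0 (inl (i, k)).
    rewrite w_pair // ler_pdivlMr // mulrAC ler_ndivrMr // subr_ge0.
    by rewrite mulrC [r k * _]mulrC.
  exists (fun j => if j == j0 then t else x j) => i.
  rewrite big_cons eqxx -lerBrDr.
  rewrite (eq_big_seq (fun j => a i j * x j)); last first.
    by move=> j js; case: eqP => // jj0; rewrite -jj0 js in j0s.
  rewrite -/(e i) -/(r i).
  case: (ltgtP (e i) 0) => ei.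
  - by have := t_ge i ei; rewrite ler_ndivrMr // mulrC.
  - by have := t_le i ei; rewrite ler_pdivlMr // mulrC.
  by rewrite ei mul0r; have := r_ge0 (inr i); rewrite w_single.
right; exists (fun l => \sum_p y p * w p l).
have exch c : \sum_l (\sum_p y p * w p l) * c l
    = \sum_p y p * \sum_l w p l * c l.
  under eq_bigr do rewrite mulr_suml.
  rewrite exchange_big; apply: eq_bigr => p _; rewrite mulr_sumr.
  by apply: eq_bigr => l _; rewrite mulrA.
split=> [l|j|]; last by rewrite exch.
  by apply: sumr_ge0 => p _; rewrite mulr_ge0.
rewrite exch inE => /predU1P[->|/ya//].
by rewrite big1 // => p _; rewrite w_e mulr0.
Qed.

(** The sign conditions enter [fourier_motzkin] as extra rows; their multipliers become the slack in
    the inequalities on [y]. *)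
Lemma farkas_nonneg (R : realFieldType) (I J : finType) (D : pred J)
    (a : I -> J -> R) (b : I -> R) :
  (exists x, (forall j, D j -> 0 <= x j) /\
     (forall i, b i <= \sum_(j | D j) a i j * x j)) \/
  (exists y, [/\ forall i, 0 <= y i,
     forall j, D j -> \sum_i y i * a i j <= 0 & 0 < \sum_i y i * b i]).
Proof.
pose a' (p : I + J) j : R :=
  match p with inl i => - a i j | inr k => - (j == k)%:R end.
pose b' (p : I + J) : R :=
  match p with inl i => - b i | inr k => 0 end.
pose s := [seq j <- index_enum J | D j].
have s_uniq : uniq s by rewrite filter_uniq ?index_enum_uniq.
have [[x xP]|[y [y_ge0 ya yb]]] := @fourier_motzkin R J s s_uniq _ a' b'.
  left; exists x; split=> [j Dj|i].
    have := xP (inr j); rewrite big_filter /= (bigD1 j) //=.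
    rewrite eqxx big1 => [|k /andP[_ /negPf->]]; last by rewrite oppr0 mul0r.
    by rewrite mulN1r addr0 oppr_le0.
  have := xP (inl i); rewrite big_filter /=.
  under eq_bigr do rewrite mulNr.
  by rewrite sumrN lerN2.
right; exists (fun i => y (inl i)); split=> // [j Dj|].
  have := ya j; rewrite mem_filter Dj mem_index_enum => /(_ isT).
  rewrite big_sumType /= [X in _ + X](bigD1 j) //= eqxx [X in _ + (_ + X)]big1.
    rewrite addr0 mulrN1 => /eqP; rewrite subr_eq0.
    under eq_bigr do rewrite mulrN.
    rewrite sumrN => /eqP yj.
    by rewrite -oppr_ge0 yj.
  by move=> k /negPf jk; rewrite eq_sym jk oppr0 mulr0.
move: yb; rewrite big_sumType /= [X in _ + X]big1 => [|k _]; last first.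
  by rewrite mulr0.
under eq_bigr do rewrite mulrN.
by rewrite sumrN addr0 oppr_lt0.
Qed.

(** On [P], [f] is a maximum of finitely many affine forms, so [P x] together with [f x <= inf S] is
    a linear system. Were it infeasible, its Farkas certificate would keep [f] away from its
    infimum. This form covers both total and local weights. *)
Lemma polyhedral_minimum (R : realType) (I J K : finType) (D : pred J)
    (a : I -> J -> R) (b : I -> R) (c : K -> J -> R) (d : K -> R)
    (P : set (J -> R)) (f : (J -> R) -> R) :
  (forall x, P x <-> (forall j, D j -> 0 <= x j) /\
     (forall i, b i <= \sum_(j | D j) a i j * x j)) ->
  (forall x t, P x ->
     f x <= t <-> forall k, d k + \sum_(j | D j) c k j * x j <= t) ->
  P !=set0 -> lbound [set f x | x in P] 0 ->
  is_minimum [set f x | x in P] (inf [set f x | x in P]).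
Proof.
move=> PE fE P0 f_ge0; set S := [set f x | x in P].
have S_inf : has_inf S by split; [exact: image_nonempty | exists 0].
have inf_le : lbound S (inf S) by apply: ge_inf; case: S_inf.
split=> //.
pose a' (p : I + K) j := match p with inl i => a i j | inr k => - c k j end.
pose b' (p : I + K) := match p with inl i => b i | inr k => d k - inf S end.
have [[x [x_ge0 xP]]|[y [y_ge0 ya yb]]] := @farkas_nonneg R _ J D a' b'.
  have Px : P x by apply/PE; split=> // i; exact: xP (inl i).
  exists x => //; apply/le_anti/andP; split; last by apply: inf_le; exists x.
  apply/(fE _ _ Px) => k; have := xP (inr k) => /=.
  under eq_bigr do rewrite mulNr.
  by rewrite sumrN; lra.
exfalso.
set g := \sum_i y i * b' i in yb; set q := \sum_k y (inr k).
have q_ge0 : 0 <= q by apply: sumr_ge0.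
have gap x : P x -> g <= q * (f x - inf S).
  move=> Px; have /PE[x_ge0 xP] := Px; have /(fE _ _ Px) fx := lexx (f x).
  have : \sum_(j | D j) (\sum_p y p * a' p j) * x j <= 0.
    by apply: sumr_le0 => j Dj; rewrite mulr_le0_ge0 ?ya ?x_ge0.
  have -> : \sum_(j | D j) (\sum_p y p * a' p j) * x j
      = \sum_p y p * \sum_(j | D j) a' p j * x j.
    under eq_bigr do rewrite mulr_suml.
    rewrite exchange_big; apply: eq_bigr => l _; rewrite mulr_sumr.
    by apply: eq_bigr => j _; rewrite mulrA.
  rewrite big_sumType /= => yx_le0; rewrite /g /q mulr_suml big_sumType /=.
  have yI : \sum_i y (inl i) * b i
      <= \sum_i y (inl i) * \sum_(j | D j) a i j * x j.
    by apply: ler_sum => i _; rewrite ler_wpM2l.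
  have yK : \sum_k y (inr k) * (d k - inf S) - \sum_k y (inr k) * (f x - inf S)
      <= \sum_k y (inr k) * \sum_(j | D j) - c k j * x j.
    rewrite -sumrB; apply: ler_sum => k _; rewrite -mulrBr ler_wpM2l //.
    have := fx k; under [X in _ -> _ <= X]eq_bigr do rewrite mulNr.
    by rewrite sumrN; lra.
  lra.
(* The denominator [q + 1] stays positive when [q = 0], and still [q * (g / (q + 1)) < g]. *)
have eps_gt0 : 0 < g / (q + 1) by rewrite divr_gt0 // ltr_wpDl.
have [_ [x Px <-] fx] := inf_adherent eps_gt0 S_inf.
have := gap x Px; rewrite leNgt => /negP; apply.
have [q0|q_neq0] := eqVneq q 0; first by rewrite q0 mul0r.
have q_gt0 : 0 < q by rewrite lt_def q_neq0.
have fx' : f x - inf S < g / (q + 1) by rewrite ltrBlDl.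
rewrite (lt_trans (y := q * (g / (q + 1)))) ?ltr_pM2l //.
by rewrite mulrA ltr_pdivrMr ?ltr_wpDl // mulrC ltr_pM2l // ltrDl.
Qed.

(** * Fractional colorings and linear programming duality *)

Lemma indep_setsP (V : finType) (E : rel V) (A : {set V}) :
  reflect {in A &, forall u v, ~~ E u v} (A \in indep_sets E).
Proof.
rewrite inE; apply: (iffP forall_inP) => [AP u v uA vA|AP u uA].
  exact: (forall_inP (AP u uA)).
by apply/forall_inP => v; exact: AP.
Qed.
Arguments indep_setsP {V E A}.

Lemma sum_mulrb (R : pzRingType) (I : finType) (P C : pred I) (x : I -> R) :
  \sum_(i | P i && C i) x i = \sum_(i | P i) (C i)%:R * x i.
Proof.
by rewrite big_mkcondr; apply: eq_bigr => i _; rewrite -mulrb mulr_natl.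
Qed.

Section FractionalColoring.
Variables (R : realType) (V : finType) (E : rel V).

Lemma fractional_coloringE (x : {set V} -> R) :
  fractional_coloring E x <->
  (forall A, A \in indep_sets E -> 0 <= x A) /\
  (forall v, 1 <= \sum_(A in indep_sets E) (v \in A)%:R * x A).
Proof.
by split=> -[x_ge0 xP]; split=> // v; have := xP v; rewrite sum_mulrb.
Qed.

Lemma fractional_coloring_nonempty :
  irreflexive E -> [set x : {set V} -> R | fractional_coloring E x] !=set0.
Proof.
move=> E_irr; exists (fun=> 1); split=> // v.
rewrite (bigD1 [set v]%SET) /=; first by rewrite lerDl sumr_ge0.
rewrite set11 andbT; apply/indep_setsP => u w /set1P -> /set1P ->.
by rewrite E_irr.
Qed.

Lemma total_weights_minimum :
  irreflexive E ->
  is_minimum (total_weights R E) (fractional_chromatic_number R E).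
Proof.
move=> E_irr; apply: (@polyhedral_minimum R V _ unit (mem (indep_sets E))
  (fun v A => (v \in A)%:R) (fun=> 1) (fun _ _ => 1) (fun=> 0)).
- exact: fractional_coloringE.
- move=> x t _; under [X in _ <-> (_ -> _ + X <= _)]eq_bigr do rewrite mul1r.
  by rewrite add0r; split=> // /(_ tt).
- exact: fractional_coloring_nonempty.
by move=> _ [x [x_ge0 _] <-]; apply: sumr_ge0 => A; exact: x_ge0.
Qed.

Lemma total_weight_average (z : V -> R) (x : {set V} -> R) :
  \sum_(A in indep_sets E) x A * \sum_(v in A) z v
    = \sum_v z v * \sum_(A in indep_sets E | v \in A) x A.
Proof.
under eq_bigr do rewrite mulr_sumr.
under [RHS]eq_bigr do rewrite mulr_sumr.
rewrite (exchange_big_dep predT) //=; apply: eq_bigr => v _.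
by apply: eq_bigr => A _; rewrite mulrC.
Qed.

(** If no such [z] exists, the Farkas multipliers of the independent sets, rescaled, form a
    fractional coloring lighter than the minimum. *)
Lemma fractional_clique :
  irreflexive E ->
  exists z : V -> R, [/\ forall v, 0 <= z v,
    forall A, A \in indep_sets E -> \sum_(v in A) z v <= 1
    & fractional_chromatic_number R E <= \sum_v z v].
Proof.
move=> E_irr; set chi := fractional_chromatic_number R E.
have [_ chi_le] := total_weights_minimum E_irr.
(* Row [None] bounds the sum of [z] from below, row [Some A] bounds [z(A)] by 1. For [A] not
   independent the row reads [-1 <= 0]. *)
pose a (p : option {set V}) v : R :=
  if p is Some A then - ((A \in indep_sets E) && (v \in A))%:R else 1.
pose b (p : option {set V}) : R := if p is Some A then -1 else chi.
have [[z [z_ge0 zP]]|[y [y_ge0 ya yb]]] := @farkas_nonneg R _ V predT a b.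
  exists z; split=> [v|A AE|]; first exact: z_ge0.
    have := zP (Some A); rewrite /= AE /=; under eq_bigr do rewrite mulNr.
    rewrite sumrN lerN2; apply: le_trans; rewrite big_mkcond /=.
    by apply: ler_sum => v _; case: ifP; rewrite ?mul1r ?mul0r.
  by have := zP None; rewrite /=; under eq_bigr do rewrite mul1r.
exfalso; set tau := y None.
have sum_option (F : option {set V} -> R) :
    \sum_p F p = F None + \sum_A F (Some A).
  rewrite (bigD1 None) //=; congr (_ + _).
  rewrite (reindex_omap Some id) /= => [|[]//].
  by apply: eq_bigl => A; rewrite /= eqxx.
have cover v : tau <= \sum_(A in indep_sets E | v \in A) y (Some A).
  have := ya v isT; rewrite sum_option /= mulr1 -/tau -lerBrDr sub0r -sumrN.
  move=> /le_trans; apply; rewrite [leRHS]big_mkcond /=; apply: ler_sum => A _.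
  by case: ifP => _; rewrite mulrN opprK ?mulr1 ?mulr0.
have weight : \sum_(A in indep_sets E) y (Some A) < tau * chi.
  move: yb; rewrite sum_option /= -/tau.
  under eq_bigr do rewrite mulrN1.
  rewrite sumrN subr_gt0; apply: le_lt_trans.
  rewrite [leRHS](bigID (mem (indep_sets E))) /= lerDl.
  exact: sumr_ge0.
(* If [tau = 0], a sum of nonnegative terms would be negative; otherwise [cover] and [weight] can be
   divided by [tau]. *)
have [tau0|tau_neq0] := eqVneq tau 0.
  move: weight; rewrite tau0 mul0r ltNge => /negP; apply.
  exact: sumr_ge0.
have tau_gt0 : 0 < tau by rewrite lt_def tau_neq0 y_ge0.
have : chi <= total_weight E (fun A => y (Some A) / tau).
  apply: chi_le; exists (fun A => y (Some A) / tau) => //; split=> [A _|v].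
    by rewrite divr_ge0 // ltW.
  by rewrite -mulr_suml ler_pdivlMr ?mul1r.
by rewrite /total_weight -mulr_suml ler_pdivlMr // leNgt mulrC weight.
Qed.

End FractionalColoring.

(** * Local weights and the upper bound *)

(** For empty [V] the right side would hold for every [t], although the local weight is then 1. *)
Lemma local_weight_le (R : realType) (V : finType) (D : rel V)
    (x : {set V} -> R) (t : R) :
  (0 < #|V|)%N -> (forall A, A \in indep_sets (underlying D) -> 0 <= x A) ->
  local_weight D x <= t <->
  forall v, 1 + \sum_(A in indep_sets (underlying D) |
     (out_neighbors D v :&: A)%SET != finset.set0) x A <= t.
Proof.
move=> /card_gt0P[v0 _] x_ge0; rewrite /local_weight -lerBrDl; split.
  move=> le_t v; rewrite -lerBrDl; apply: le_trans le_t.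
  exact: (@le_bigmax _ R V 0).
move=> le_t; apply: bigmax_le => [|v _]; last by rewrite lerBrDl.
have := le_t v0; rewrite -lerBrDl; apply: le_trans.
by apply: sumr_ge0 => A /andP[AD _]; exact: x_ge0.
Qed.

Lemma local_weights_minimum (R : realType) (V : finType) (D : rel V) :
  (0 < #|V|)%N -> irreflexive (underlying D) ->
  is_minimum (local_weights R D)
    (fractional_directed_local_chromatic_number R D).
Proof.
move=> V_gt0 D_irr.
apply: (@polyhedral_minimum R V _ V (mem (indep_sets (underlying D)))
  (fun v A => (v \in A)%:R) (fun=> 1)
  (fun v A => ((out_neighbors D v :&: A)%SET != finset.set0)%:R) (fun=> 1)).
- exact: fractional_coloringE.
- move=> x t [x_ge0 _]; rewrite local_weight_le //.
  by split=> le_t v; have := le_t v; rewrite sum_mulrb.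
- exact: fractional_coloring_nonempty.
move=> _ [x _ <-]; rewrite addr_ge0 //.
by apply: bigmax_ge_id.
Qed.

Lemma underlying_orientation (V : finType) (E D : rel V) :
  symmetric E -> is_orientation E D -> underlying D = E.
Proof.
move=> E_sym [DE ED]; apply/funext => u; apply/funext => v.
apply/idP/idP => [/orP[/DE//|/DE]|/ED]; first by rewrite E_sym.
by rewrite /underlying; case: (D u v).
Qed.

Lemma local_weight_le_total_weight (R : realType) (V : finType) (D : rel V)
    (x : {set V} -> R) :
  (0 < #|V|)%N -> fractional_coloring (underlying D) x ->
  local_weight D x <= total_weight (underlying D) x.
Proof.
move=> V_gt0 [x_ge0 xP]; apply/local_weight_le => // v.
(* The sets containing [v] pay for the leading 1; those meeting its out-neighborhood are among the
   others. *)
rewrite /total_weight [leRHS](bigID (fun A : {set V} => v \in A)) /=.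
apply: lerD; first exact: xP.
rewrite big_mkcondr [leRHS]big_mkcondr /=; apply: ler_sum => A AD.
case: ifP => [/set0Pn[u /setIP[]]|_]; last by case: ifP; rewrite ?x_ge0.
rewrite inE => Dvu uA; rewrite ifT //; apply/negP => vA.
by have := elimT indep_setsP AD _ _ vA uA; rewrite /underlying Dvu.
Qed.

(** * An extremal orientation and the lower bound *)

(* All edges meeting [B] leave [B]; the ranking of the vertices only serves to
   orient the remaining edges. *)
Definition orient_out (V : finType) (E : rel V) (B : {set V}) : rel V :=
  fun u v => E u v &&
    ((u \in B) || (v \notin B) && (enum_rank u < enum_rank v)%N).

Lemma orient_out_orientation (V : finType) (E : rel V) (B : {set V}) :
  symmetric E -> irreflexive E -> B \in indep_sets E ->
  is_orientation E (orient_out E B).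
Proof.
move=> E_sym E_irr BE; split=> u v; first by case/andP.
move=> Euv; rewrite /orient_out (E_sym v u) Euv /=.
have : ~~ ((u \in B) && (v \in B)).
  apply/negP => /andP[uB vB].
  by have := elimT indep_setsP BE _ _ uB vB; rewrite Euv.
case: (u \in B) (v \in B) => [] [] //= _.
case: ltngtP => // /ord_inj/enum_rank_inj uv.
by rewrite uv E_irr in Euv.
Qed.

(* If [B'] is the part of [B] with no out-neighbor in [A], then
   [(A :\: B) :|: B'] is independent, so its weight is at most that of [B]. *)
Lemma orient_out_clique (R : realType) (V : finType) (E : rel V)
    (z : V -> R) (B A : {set V}) :
  symmetric E ->
  (forall A', A' \in indep_sets E -> \sum_(v in A') z v <= \sum_(v in B) z v) ->
  B \in indep_sets E -> A \in indep_sets E ->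
  \sum_(v in (A :\: B)%SET) z v <=
  \sum_(v in B | (out_neighbors (orient_out E B) v :&: A)%SET != finset.set0)
     z v.
Proof.
move=> E_sym B_max BE AE.
pose hit v := (out_neighbors (orient_out E B) v :&: A)%SET != finset.set0.
pose B' := [set v in B | ~~ hit v]%SET.
(* Every edge at a vertex of [B] leaves it, so a vertex of [B] without out-neighbors in [A] has no
   neighbors there at all. *)
have no_edge u v : u \in A -> v \in B' -> ~~ E v u.
  rewrite inE => uA /andP[vB /negPn/eqP hit0]; apply/negP => Evu.
  by have := finset.in_set0 u; rewrite -hit0 !inE uA /orient_out Evu vB.
have AB'_indep : ((A :\: B) :|: B')%SET \in indep_sets E.
  apply/indep_setsP => u v /setUP[/setDP[uA _]|uB'] /setUP[/setDP[vA _]|vB'].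
  - exact: (elimT indep_setsP AE).
  - by rewrite E_sym no_edge.
  - exact: no_edge.
  move: uB' vB'; rewrite !inE => /andP[uB _] /andP[vB _].
  exact: (elimT indep_setsP BE).
have := B_max _ AB'_indep; rewrite [leRHS](bigID hit) [leLHS](bigID (mem B)) /=.
have -> : \sum_(v in (A :\: B :|: B')%SET | v \in B) z v
    = \sum_(v in B | ~~ hit v) z v.
  by apply: eq_bigl => v; rewrite !inE; case: (v \in B); rewrite ?andbT ?andbF.
have -> : \sum_(v in (A :\: B :|: B')%SET | v \notin B) z v
    = \sum_(v in (A :\: B)%SET) z v.
  apply: eq_bigl => v; rewrite !inE.
  by case: (v \in B); rewrite ?orbF ?andbT ?andbF.
by rewrite addrC lerD2r.
Qed.

Lemma orient_out_local_weight (R : realType) (V : finType) (E : rel V)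
    (z : V -> R) (B : {set V}) (x : {set V} -> R) :
  (0 < #|V|)%N -> symmetric E -> irreflexive E ->
  (forall v, 0 <= z v) ->
  (forall A, A \in indep_sets E -> \sum_(v in A) z v <= 1) ->
  B \in indep_sets E -> 1 <= \sum_(v in B) z v ->
  fractional_coloring E x ->
  \sum_v z v <= local_weight (orient_out E B) x.
Proof.
move=> V_gt0 E_sym E_irr z_ge0 z_le1 BE zB_ge1 [x_ge0 xP].
have zB : \sum_(v in B) z v = 1 by apply/le_anti; rewrite z_le1.
set D := orient_out E B; set W := local_weight D x.
have DE : underlying D = E.
  by apply: underlying_orientation => //; exact: orient_out_orientation.
pose hit v A := (out_neighbors D v :&: A)%SET != finset.set0.
have hit_le v : \sum_(A in indep_sets E | hit v A) x A <= W - 1.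
  have := iffLR (local_weight_le W V_gt0 _) (lexx W) v.
  by rewrite DE lerBrDl; apply.
rewrite (bigID (mem B)) /= zB -lerBrDl.
(* The bounds [hit_le] are averaged over [B] with weights [z], which sum to 1 there. *)
apply: (@le_trans _ _ (\sum_(v in B) z v *
    \sum_(A in indep_sets E | hit v A) x A)); last first.
  rewrite -[leRHS]mul1r -[X in _ <= X * _]zB mulr_suml.
  by apply: ler_sum => v _; rewrite ler_wpM2l.
(* Each vertex outside [B] is covered with weight at least 1. Exchanging the sums then reduces the
   comparison to a single independent set [A]. *)
apply: (@le_trans _ _ (\sum_(v | v \notin B) z v *
    \sum_(A in indep_sets E | v \in A) x A)).
  by apply: ler_sum => v _; rewrite ler_peMr.
under eq_bigr do rewrite mulr_sumr.
under [leRHS]eq_bigr do rewrite mulr_sumr.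
rewrite (exchange_big_dep (mem (indep_sets E))) => [|v A _ /andP[]//].
rewrite [leRHS](exchange_big_dep (mem (indep_sets E))) => [|v A _ /andP[]//].
apply: ler_sum => A /= AE; rewrite -!mulr_suml ler_wpM2r ?x_ge0 //.
rewrite AE; apply: le_trans (orient_out_clique E_sym _ BE AE).
  by rewrite le_eqVlt; apply/predU1P; left; apply: eq_bigl => v; rewrite inE.
by move=> A' /z_le1; rewrite zB.
Qed.

Lemma exists_orientation_local_weight (R : realType) (V : finType) (E : rel V) :
  (0 < #|V|)%N -> symmetric E -> irreflexive E ->
  exists2 D : rel V, is_orientation E D &
    lbound (local_weights R D) (fractional_chromatic_number R E).
Proof.
move=> V_gt0 E_sym E_irr; set chi := fractional_chromatic_number R E.
have [z [z_ge0 z_le1 chi_le]] := fractional_clique R E_irr.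
have [[x [x_ge0 xP] /= x_chi] _] := total_weights_minimum R E_irr.
have E0 : finset.set0 \in indep_sets E.
  by apply/indep_setsP => u v; rewrite inE.
have [B BE B_max] : exists2 B, B \in indep_sets E &
    forall A, A \in indep_sets E -> \sum_(v in A) z v <= \sum_(v in B) z v.
  exists [arg max_(B > finset.set0 in indep_sets E) \sum_(v in B) z v]%O.
    by case: arg_maxP.
  by case: arg_maxP.
have chi_gt0 : 0 < chi.
  have /card_gt0P[v _] := V_gt0.
  rewrite /chi -x_chi (lt_le_trans _ (le_trans (xP v) _)) //.
  rewrite /total_weight [leRHS](bigID (fun A : {set V} => v \in A)) /= lerDl.
  by apply: sumr_ge0 => A /andP[AE _]; exact: x_ge0.
(* With [x] optimal, [chi <= z(V) <= \sum_A x A * z(A) <= chi * z(B)], and [chi > 0] cancels. *)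
have zB : 1 <= \sum_(v in B) z v.
  rewrite -(ler_pM2l chi_gt0) mulr1 (le_trans chi_le) //.
  apply: (@le_trans _ _ (\sum_(A in indep_sets E) x A * \sum_(v in A) z v)).
    by rewrite total_weight_average; apply: ler_sum => v _; rewrite ler_peMr.
  rewrite /chi -x_chi mulr_suml; apply: ler_sum => A AE.
  by rewrite ler_wpM2l ?x_ge0 ?B_max.
have D_or := orient_out_orientation E_sym E_irr BE.
exists (orient_out E B) => // _ [y /= yP <-].
apply: le_trans chi_le (orient_out_local_weight _ _ _ _ _ _ _ _) => //.
by rewrite -(underlying_orientation E_sym D_or).
Qed.

Theorem theorem3 (R : realType) (V : finType) (E : rel V)
    (V_nonempty : (0 < #|V|)%N) (E_sym : symmetric E) (E_irr : irreflexive E) :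
  [/\ is_minimum (total_weights R E) (fractional_chromatic_number R E),
      forall D : rel V, is_orientation E D ->
        is_minimum (local_weights R D)
          (fractional_directed_local_chromatic_number R D)
    & is_maximum
        [set fractional_directed_local_chromatic_number R D
           | D in [set D : rel V | is_orientation E D]]
        (fractional_chromatic_number R E)].
Proof.
have tot_min := total_weights_minimum R E_irr.
have loc_min D : is_orientation E D -> is_minimum (local_weights R D)
    (fractional_directed_local_chromatic_number R D).
  move=> D_or; apply: local_weights_minimum => //.
  by rewrite (underlying_orientation E_sym D_or).
have psi_le D : is_orientation E D ->
    fractional_directed_local_chromatic_number R D
      <= fractional_chromatic_number R E.
  move=> D_or; have DE := underlying_orientation E_sym D_or.
  have [[x /= xP <-] _] := tot_min; have [_ psi_lb] := loc_min D D_or.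
  rewrite -DE in xP *.
  apply: le_trans (local_weight_le_total_weight _ xP) => //.
  by apply: psi_lb; exists x.
split=> //; split=> [|_ [D D_or <-]]; last exact: psi_le.
have [D D_or chi_lb] :=
  exists_orientation_local_weight R V_nonempty E_sym E_irr.
(* The infimum for [D] is attained, hence itself a local weight, so [chi_lb] applies to it. *)
exists D => //; apply/le_anti; rewrite psi_le //=.
by apply: chi_lb; have [] := loc_min D D_or.
Qed.
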